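(* Let $G$ be a graph with vertex set $[n]$ and let $r_1 = \cdots = r_n = 2$. Then the marginal semigroup $\mathcal{S}_G$ is normal if and only if $G$ is free of $K_4$ minors (i.e. the complete graph $K_4$ is not a minor of $G$).
   Context: Let $n$ be a positive integer, $[n]=\{1,\dots,n\}$, and let $r_1,\dots,r_n$ be positive integers. For $F\subseteq[n]$ let $\mathcal{R}_F=\prod_{i\in F}[r_i]$ (so $\mathcal{R}_\emptyset$ has exactly one element), and $\mathcal{R}=\mathcal{R}_{[n]}$. For a finite set $A$, $\mathbb{R}^A$ is the real vector space with basis $\{e_a: a\in A\}$. For $\mathbf{i}=(i_1,\dots,i_n)\in\mathcal{R}$ and $F\subseteq[n]$ put $\mathbf{i}_F=(i_f)_{f\in F}\in \mathcal{R}_F$. For a simplicial complex $\Delta\subseteq 2^{[n]}$ (a collection of subsets closed under taking subsets, including $\emptyset$), the marginal map is the linear map $$\pi_\Delta:\mathbb{R}^{\mathcal{R}}\to\bigoplus_{F\in\Delta}\mathbb{R}^{\mathcal{R}_F},\qquad e_{\mathbf{i}}\mapsto\bigoplus_{F\in\Delta}e_{\mathbf{i}_F}.$$ The marginal cone is $\mathcal{C}_\Delta=\pi_\Delta(\mathbb{R}^{\mathcal{R}}_{\ge0})$ and the marginal semigroup is $\mathcal{S}_\Delta=\pi_\Delta(\mathbb{N}^{\mathcal{R}})$, where $\mathbb{N}$ denotes the nonnegative integers. The semigroup $\mathcal{S}_\Delta$ is called normal if every integral point of $\mathcal{C}_\Delta$ lies in $\mathcal{S}_\Delta$, i.e. $\mathcal{C}_\Delta\cap\bigoplus_{F\in\Delta}\mathbb{Z}^{\mathcal{R}_F}=\mathcal{S}_\Delta$.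 A graph $G$ (finite, simple, undirected) with vertex set $[n]$ is regarded as the simplicial complex consisting of $\emptyset$, all singletons $\{i\}$ with $i\in[n]$, and all edges $\{j,k\}$ of $G$; $\mathcal{C}_G$ and $\mathcal{S}_G$ denote the corresponding marginal cone and semigroup. *)

(* Defs.v *)
From HB Require Import structures.
From mathcomp Require Import all_boot all_order all_algebra.
From mathcomp Require Import classical_sets reals.
From mathcomp Require Import fintype finset.

Set Implicit Arguments.
Unset Strict Implicit.
Unset Printing Implicit Defensive.

Import Order.TTheory GRing.Theory Num.Theory.
Local Open Scope ring_scope.

Definition simplicial_complex (n : nat) (Delta : {set {set 'I_n}}) : Prop :=
  set0 \in Delta /\
  forall F E : {set 'I_n}, F \in Delta -> E \subset F -> E \in Delta.

(* The vertices 1, ..., n and the levels 1, ..., r_i are shifted to start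
   from 0. *)
Definition cell (n : nat) (r : 'I_n -> nat) : finType :=
  {dffun forall i : 'I_n, 'I_(r i)}.

Definition face_cell (n : nat) (r : 'I_n -> nat) (F : {set 'I_n}) : finType :=
  {dffun forall f : {f : 'I_n | f \in F}, 'I_(r (val f))}.

Definition restrict (n : nat) (r : 'I_n -> nat) (F : {set 'I_n})
    (i : cell r) : face_cell r F :=
  [ffun f : {f : 'I_n | f \in F} => i (val f)].

Definition basis_vec (R : realType) (A : finType) (a : A) : {ffun A -> R^o} :=
  [ffun b => (b == a)%:R].

(* The direct sum of the R^(A_F), F in Delta, is represented as R^A with A the
   disjoint union of the A_F. *)
Definition marginal_index (n : nat) (r : 'I_n -> nat)
    (Delta : {set {set 'I_n}}) : finType :=
  {F : {F : {set 'I_n} | F \in Delta} & face_cell r (val F)}.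

Definition marginal_cell (n : nat) (r : 'I_n -> nat)
    (Delta : {set {set 'I_n}}) (F : {F : {set 'I_n} | F \in Delta})
    (i : cell r) : marginal_index r Delta :=
  existT _ F (restrict (val F) i).

Section Marginal.
Variables (R : realType) (n : nat) (r : 'I_n -> nat).
Variable Delta : {set {set 'I_n}}.

Definition marginal_map (x : {ffun cell r -> R^o}) :
    {ffun marginal_index r Delta -> R^o} :=
  \sum_(i : cell r) x i *:
    \sum_(F : {F : {set 'I_n} | F \in Delta})
      basis_vec R (marginal_cell F i).

Fact marginal_map_is_linear : linear marginal_map.
Proof.
move=> a x y; rewrite /marginal_map scaler_sumr -big_split /=.
by apply: eq_bigr => i _; rewrite !ffunE scalerDl scalerA.
Qed.

HB.instance Definition _ := GRing.isLinear.Build R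
  {ffun cell r -> R^o} {ffun marginal_index r Delta -> R^o} *:%R
  marginal_map marginal_map_is_linear.

Lemma marginal_map_basis (i : cell r) :
  marginal_map (basis_vec R i) =
  \sum_(F : {F : {set 'I_n} | F \in Delta})
    basis_vec R (marginal_cell F i).
Proof.
rewrite /marginal_map (bigD1 i isT) /=.
have E j : basis_vec R i j = (j == i)%:R by rewrite /basis_vec ffunE.
rewrite {1}E eqxx scale1r [X in _ + X]big1 ?addr0 // => j /negPf ji.
by rewrite E ji scale0r.
Qed.

Local Open Scope classical_set_scope.

Definition marginal_cone : set {ffun marginal_index r Delta -> R^o} :=
  marginal_map @` [set x : {ffun cell r -> R^o} | forall i, 0 <= (x i : R)].

Definition marginal_semigroup : set {ffun marginal_index r Delta -> R^o} :=
  marginal_map @` [set x : {ffun cell r -> R^o} |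
                   forall i, (x i : R) \is a Num.nat].

Definition integral_points : set {ffun marginal_index r Delta -> R^o} :=
  [set y | forall k, (y k : R) \is a Num.int].

Definition marginal_normal : Prop :=
  marginal_cone `&` integral_points = marginal_semigroup.

End Marginal.

Definition graph_complex (n : nat) (e : rel 'I_n) : {set {set 'I_n}} :=
  [set F : {set 'I_n} | [|| F == set0,
     [exists i, F == [set i]%SET] |
     [exists j, exists k, e j k && (F == [set j; k]%SET)]]]%SET.

Fact graph_complex_simplicial (n : nat) (e : rel 'I_n) :
  simplicial_complex (graph_complex e).
Proof.
split=> [|F E]; first by rewrite inE eqxx.
rewrite !inE => /or3P[/eqP->|/existsP[i /eqP->]|].
- by rewrite subset0 => ->.
- rewrite subset1 => /orP[/eqP->|->//].
  by apply/or3P/Or32/existsP; exists i.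
case/existsP=> j /existsP[k /andP[ejk /eqP->]].
move=> sE; have [jE|jE] := boolP (j \in E); have [kE|kE] := boolP (k \in E).
- apply/or3P/Or33/existsP; exists j; apply/existsP; exists k.
  by rewrite ejk eqEsubset sE subUset !sub1set jE kE.
- apply/or3P/Or32/existsP; exists j; rewrite eqEsubset sub1set jE andbT.
  apply/subsetP=> x xE; have /set2P[->|xk] := subsetP sE x xE.
    by rewrite inE.
  by rewrite -xk xE in kE.
- apply/or3P/Or32/existsP; exists k; rewrite eqEsubset sub1set kE andbT.
  apply/subsetP=> x xE; have /set2P[xj|->] := subsetP sE x xE.
    by rewrite -xj xE in jE.
  by rewrite inE.
apply/or3P/Or31; rewrite -subset0; apply/subsetP=> x xE.
have /set2P[xj|xk] := subsetP sE x xE.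
  by rewrite -xj xE in jE.
by rewrite -xk xE in kE.
Qed.

Definition connected_in (T : finType) (e : rel T) (B : {set T}) : Prop :=
  {in B &, forall x y,
    connect [rel u v | [&& u \in B, v \in B & e u v]] x y}.

(* [h] is a minor of [e]: the vertices of [h] are modelled by pairwise disjoint
   connected branch sets in [e], with an edge of [e] between the branch sets of
   any two adjacent vertices of [h]. *)
Definition is_minor (S T : finType) (h : rel S) (e : rel T) : Prop :=
  exists B : S -> {set T},
    [/\ forall s, B s != set0,
        forall s t, s != t -> [disjoint B s & B t],
        forall s, connected_in e (B s) &
        forall s t, h s t -> exists x y, [/\ x \in B s, y \in B t & e x y]].

Definition complete_graph (m : nat) : rel 'I_m := [rel i j | i != j].
Arguments complete_graph m : clear implicits.

(* Main.v *)
Require Import Defs.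
From mathcomp Require Import all_boot all_order all_algebra.
From mathcomp Require Import classical_sets reals.
From mathcomp Require Import fintype finset zify lra.

(** A point of the cone is the vector of masses that a nonnegative real weight
    on the cells gives to the events bit i = 1 and bit i = bit j = 1, together
    with its total mass. The semigroup is the case of natural weights, that is,
    of finite sequences of samples.

    If [K_4] is a minor, with branch sets [B_0, ..., B_3], give weight 1/4 to
    each of the 16 cells that are constant on every branch set and 0 outside
    their union. A condition on the bits of a face involves at most two of the
    four free bits, so the marginals are integers: total mass 4, and the four
    joint values of the bits of two different branch sets have mass 1 each. A
    natural weight with the same marginals is also supported on cells constant
    on the branch sets, because adjacent bits of one branch set never differ.
    So it is an orthogonal array of strength 2 with 4 runs and 4 binary
    factors, and [no_orthogonal_array] excludes it by counting agreements with
    one run.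

    Conversely, let [K_4] not be a minor. [round_samples] proves a rounding
    statement that is stronger than normality: if the total mass and the masses
    of the bits are integers, some sequence of samples has the same total and
    bit masses, and its pair masses differ by less than 1 from the real ones on
    all edges. When the pair masses are integers too, they agree. It is because
    pair masses may be fractional that the statement can be proved by induction
    on the vertices. By [min_deg_minor] there is a vertex [v] with at most two
    neighbours [a] and [b]. Contracting [v] into [a] creates the edge [ab],
    whose real mass is arbitrary, and the induction hypothesis rounds it. It
    remains to choose how many samples of each of the four types of the pair
    [(a, b)] get bit 1 at [v], and this is a rounding problem on one triangle
    ([int_triangle_round]): its defining inequalities have integer bounds, and
    the parity obstruction that could separate the real from the integer
    solutions is excluded by the inequalities of the three edges.

    [min_deg_minor] says that a graph has a [K_4] minor if all vertices that
    are not isolated, except possibly one, have degree at least 3. The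
    exceptional vertex absorbs contractions: in each case some connected set of
    at most four vertices can be contracted without lowering any other degree
    below 3, unless a [K_4] minor is already visible. *)

Set Implicit Arguments.
Unset Strict Implicit.
Unset Printing Implicit Defensive.

Import Order.TTheory GRing.Theory Num.Theory.

(** * Contractions and minors *)
Section Contraction.
Variable T : finType.
Implicit Types (e : rel T) (S : {set T}).

(** All of [S] is merged into its element [x]; the other elements of [S] stay
    in the type as isolated vertices, so that the vertex type never changes. *)
Definition contract e S x : rel T :=
  [rel i j | [&& i \notin S :\ x, j \notin S :\ x, i != j &
    [|| e i j, (i == x) && [exists s in S, e s j]
             | (j == x) && [exists s in S, e i s]]]].

Definition nbrs e i : {set T} := [set j | e i j].

Lemma in_nbrs e i j : (j \in nbrs e i) = e i j.
Proof. by rewrite inE. Qed.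

Lemma contract_sym e S x : symmetric e -> symmetric (contract e S x).
Proof.
move=> e_sym i j; rewrite /contract /= andbCA (eq_sym j i) (e_sym j i).
do 3 congr (_ && _); congr (_ || _); rewrite orbC.
by congr (_ && _ || _ && _); apply: eq_existsb => s; rewrite (e_sym s).
Qed.

Lemma contract_irr e S x : irreflexive (contract e S x).
Proof. by move=> i; rewrite /contract /= eqxx /= !andbF. Qed.

Lemma connect_restr_sym e (B : {set T}) : symmetric e ->
  connect_sym [rel u v | [&& u \in B, v \in B & e u v]].
Proof.
by move=> e_sym; apply: sym_connect_sym => u v /=; rewrite e_sym andbCA.
Qed.

Lemma connected_in_root e (B : {set T}) x : symmetric e ->
  (forall y, y \in B ->
     connect [rel u v | [&& u \in B, v \in B & e u v]] x y) ->
  connected_in e B.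
Proof.
move=> e_sym Bx u v uB vB; apply: (connect_trans _ (Bx v vB)).
by rewrite connect_restr_sym //; apply: Bx.
Qed.

Lemma contract_edge e S x i j : irreflexive e ->
  i \notin S :\ x -> j \notin S :\ x -> e i j -> contract e S x i j.
Proof.
move=> e_irr iS jS eij; rewrite /contract /= iS jS eij andbT /=.
by apply: contraTneq eij => ->; rewrite e_irr.
Qed.

Lemma contract_root e S x s j : x \in S -> s \in S -> j \notin S -> e s j ->
  contract e S x x j.
Proof.
move=> xS sS jS esj; rewrite /contract /= !inE eqxx (negPf jS) !andbF /=.
apply/andP; split; first by apply: contraNneq jS => <-.
by apply/or3P/Or32/existsP; exists s; rewrite sS.
Qed.

(** The branch set that contains the merged vertex is enlarged by [S]. A vertex
    of [S] other than [x] lies in no branch set of the contracted graph: it is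
    isolated there, whereas every branch set has an edge that leaves it. *)
Lemma minor_contract e S x : symmetric e -> x \in S -> connected_in e S ->
  is_minor (complete_graph 4) (contract e S x) ->
  is_minor (complete_graph 4) e.
Proof.
move=> e_sym xS cS [B [B0 Bdisj Bcon Badj]].
have BS s j : j \in B s -> j \in S -> j = x.
  move=> jB jS; apply/eqP/negPn/negP => jx.
  have [t st] : exists t : 'I_4, s != t.
    by exists (if s == ord0 then ord_max else ord0);
      case: (eqVneq s ord0) => [->|].
  have [i [k [iB kB ik]]] := Badj s t st.
  have jSx : j \in S :\ x by rewrite !inE jx.
  have ij : j != i by apply: contraTneq ik => <-; rewrite /contract /= jSx.
  have /connectP[[|l p] /= pth lst] := Bcon s j i jB iB.
    by rewrite lst eqxx in ij.
  by move: pth => /=; rewrite /contract /= jSx /= !andbF.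
pose D s := if x \in B s then B s :|: S else B s.
have BD s : B s \subset D s by rewrite /D; case: ifP => // _; apply: subsetUl.
have SD s : x \in B s -> S \subset D s by rewrite /D => ->; apply: subsetUr.
have stepD s i j : connect [rel u v | [&& u \in S, v \in S & e u v]] i j ->
    x \in B s -> connect [rel u v | [&& u \in D s, v \in D s & e u v]] i j.
  move=> cij xB; apply: connect_sub cij => u v /= /and3P[uS vS euv].
  by apply: connect1; rewrite /= euv !(subsetP (SD s xB)).
exists D; split=> [s|s t st|s|s t /Badj[i [j [iB jB]]]].
- by have /set0Pn[i iB] := B0 s; apply/set0Pn; exists i;
    apply: (subsetP (BD s)).
- have dj := Bdisj s t st.
  rewrite -setI_eq0; apply/eqP/setP => i; rewrite !inE /D.
  have nij k : ~~ ((k \in B s) && (k \in B t)).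
    apply/negP => /andP[ks kt]; move: dj; rewrite -setI_eq0 => /eqP/setP/(_ k).
    by rewrite !inE ks kt.
  apply/negP; case: ifP => xs; case: ifP => xt; rewrite ?inE => /andP[].
  + by have := nij x; rewrite xs xt.
  + by move=> /orP[is_ it|iS it]; [have := nij i; rewrite is_ it
      | rewrite -(BS t i it iS) it in xt].
  + by move=> is_ /orP[it|iS]; [have := nij i; rewrite is_ it
      | rewrite -(BS s i is_ iS) is_ in xs].
  + by move=> is_ it; have := nij i; rewrite is_ it.
- have lift i j : i \in B s -> j \in B s ->
      connect [rel u v | [&& u \in D s, v \in D s & e u v]] i j.
    move=> iB jB; apply: connect_sub (Bcon s i j iB jB) => u v /= /and3P[uB vB].
    have [uD vD] := (subsetP (BD s) u uB, subsetP (BD s) v vB).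
    case/and4P=> _ _ _ /or3P[euv|/andP[/eqP ux]|/andP[/eqP vx]].
    + by apply: connect1; rewrite /= uD vD.
    + case/existsP=> k /andP[kS ekv]; rewrite ux in uB *.
      apply: connect_trans (stepD s _ _ (cS _ _ xS kS) uB) _.
      by apply: connect1; rewrite /= vD ekv (subsetP (SD s uB)).
    + case/existsP=> k /andP[kS euk]; rewrite vx in vB *.
      apply: connect_trans (stepD s _ _ (cS _ _ kS xS) vB).
      by apply: connect1; rewrite /= uD euk (subsetP (SD s vB)).
  have [xB|xB] := boolP (x \in B s); last first.
    by move=> i j; rewrite {1 2}/D (negPf xB); apply: lift.
  apply: (connected_in_root (x := x)) => // j; rewrite {1}/D xB inE.
  by case/orP=> [/(lift _ _ xB)//|jS]; apply: stepD => //; apply: cS.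
- have [iD jD] := (subsetP (BD s) i iB, subsetP (BD t) j jB).
  case/and4P=> _ _ _ /or3P[eij|/andP[/eqP ix]|/andP[/eqP jx]].
  + by exists i, j.
  + case/existsP=> k /andP[kS ekj]; exists k, j; split=> //.
    by apply: (subsetP (SD s _)); rewrite // -ix.
  + case/existsP=> k /andP[kS eik]; exists i, k; split=> //.
    by apply: (subsetP (SD t _)); rewrite // -jx.
Qed.

(** The neighbours of [i] in [S] are replaced by one neighbour [x]. *)
Lemma contract_deg e S x i : irreflexive e -> symmetric e -> i \notin S ->
  x \in S ->
  #|nbrs (contract e S x) i| + #|nbrs e i :&: S| =
    #|nbrs e i| + (nbrs e i :&: S != set0).
Proof.
move=> e_irr e_sym iS xS.
have -> : nbrs (contract e S x) i =
    if nbrs e i :&: S != set0 then x |: (nbrs e i :\: S) else nbrs e i :\: S.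
  have ix : i != x by apply: contraNneq iS => ->.
  apply/setP => j; rewrite (fun_if (fun X : {set T} => j \in X)) !(in_nbrs,
    inE) /contract /=.
    rewrite !inE (negPf iS).
  rewrite (negPf ix) /=.
  have -> : [exists s in S, e i s] = (nbrs e i :&: S != set0).
    apply/existsP/set0Pn => -[s].
      by case/andP=> sS eis; exists s; rewrite !(in_nbrs, inE) eis.
    by rewrite !(in_nbrs, inE) => /andP[eis sS]; exists s; rewrite sS.
  case: (eqVneq j x) => [->|jx] /=.
    rewrite ix /=; case: ifP => [_|/negbT]; first by rewrite orbT.
    by rewrite negbK orbF xS => /eqP/setP/(_ x);
      rewrite !(in_nbrs, inE) xS andbT.
  rewrite orbF; have [<-|ij] := eqVneq i j; last by case: ifP.
  by rewrite e_irr !andbF; case: ifP.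
have := cardsID S (nbrs e i); case: ifP => _; last lia.
by rewrite cardsU1 !(in_nbrs, inE) xS /=; lia.
Qed.

Lemma connected_in_radius2 e S x : symmetric e -> x \in S ->
  {in S, forall y, [|| y == x, e x y | [exists z in S, e x z && e z y]]} ->
  connected_in e S.
Proof.
move=> e_sym xS near; apply: (connected_in_root (x := x)) => // y yS.
case/or3P: (near y yS) => [/eqP->|exy|/existsP[z /and3P[zS exz ezy]]].
- exact: connect0.
- by apply: connect1; rewrite /= xS yS.
- by apply: (connect_trans (y := z)); apply: connect1; rewrite /= ?xS ?yS ?zS.
Qed.

Lemma cards3P (X : {set T}) a b : #|X| = 3 -> a \in X -> b \in X -> a != b ->
  exists c, [/\ X = [set a; b; c], c != a & c != b].
Proof.
move=> X3 aX bX ab.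
have /eqP/cards1P[c Xc] : #|X :\ a :\ b| = 1.
  have := cardsD1 a X; have := cardsD1 b (X :\ a).
  by rewrite aX !inE bX eq_sym ab X3 /=; lia.
have : c \in X :\ a :\ b by rewrite Xc inE.
rewrite !inE => /and3P[cb ca cX]; exists c; split=> //.
apply/setP => i; have /setP/(_ i) := Xc; rewrite !inE.
case: (eqVneq i a) => [->|ia]; first by rewrite aX.
by case: (eqVneq i b) => [->|ib]; rewrite ?bX.
Qed.

(** [contract_deg] read as a bound: [c] and [a] are the degrees before and
    after the contraction of a set that contains [b] of the neighbours. *)
Lemma deg_loss a b c : (b <= 1) || (b <= 2) && (3 < c) -> 2 < c ->
  a + b = c + (b != 0) -> 2 < a.
Proof. by case/orP=> [|/andP[]]; case: b => [|[|[|b]]] //=; lia. Qed.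

Lemma cards2_le (a b : T) : #|[set a; b]| <= 2.
Proof. by rewrite cards2; case: (a != b). Qed.

Lemma clique4_minor e a b c d : symmetric e -> irreflexive e ->
  e a b -> e a c -> e a d -> e b c -> e b d -> e c d ->
  is_minor (complete_graph 4) e.
Proof.
move=> e_sym e_irr ab ac ad bc bd cd.
pose v (s : 'I_4) := nth a [:: a; b; c; d] s.
have v_adj s t : s != t -> e (v s) (v t).
  by case: s t => [[|[|[|[|s]]]] s4] [[|[|[|[|t]]]] t4] //=;
    rewrite // /v /= e_sym.
exists (fun s => [set v s]); split=> [s|s t /v_adj st|s i j|s t /v_adj st].
- by apply/set0Pn; exists (v s); rewrite inE.
- by rewrite disjoints1 inE; apply: contraTneq st => ->; rewrite e_irr.
- by rewrite !inE => /eqP-> /eqP->; apply: connect0.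
- by exists (v s), (v t); rewrite !inE.
Qed.

(** Let [xz] be an edge at the exceptional vertex [x]. Contracting [z] into [x]
    works unless [x] and [z] have a common neighbour [w] of degree 3; let [w']
    be the third neighbour of [w]. If [w'] is adjacent to both [x] and [z],
    these four vertices are a clique. If contracting [w] into [w'] does not
    work either, then [w'] is not adjacent to [x], and [z] has degree 3 as
    well, with neighbours [x], [w] and [w']. Now the diamond [x, z, w, w'] has
    no edge to the rest of the graph but at [x] and [w'], and can be contracted
    into [x], without [w'] if this has degree at least 4. The exception is that
    [w'] has degree 3 and its third neighbour [u] is adjacent to [x]: then [x],
    [z], [w] and the edge [w'u] form a [K_4] minor. *)
Lemma min_deg_minor e (A : {set T}) x : symmetric e -> irreflexive e ->
  (forall i j, e i j -> i \in A) -> (exists z, e x z) ->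
  (forall i, i != x -> nbrs e i != set0 -> 2 < #|nbrs e i|) ->
  is_minor (complete_graph 4) e.
Proof.
have [m] := ubnP #|A|; elim: m e A x => // m IHm e A x Am e_sym e_irr eA.
case=> z exz deg3.
have nbrs0 i j : e i j -> nbrs e i != set0.
  by move=> eij; apply/set0Pn; exists j; rewrite in_nbrs.
have neq i j : e i j -> i != j.
  by apply: contraTneq => ->; rewrite e_irr.
have step S x0 y : x0 \in S -> connected_in e S -> x0 \in A ->
    y \in S -> y \in A -> y != x0 -> (exists j, contract e S x0 x j) ->
    (x0 != x -> 2 < #|nbrs (contract e S x0) x0|) ->
    (forall i, i \notin S -> i != x -> nbrs e i != set0 ->
      (#|nbrs e i :&: S| <= 1) || (#|nbrs e i :&: S| <= 2) && (3 < #|nbrs e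
        i|)) ->
    is_minor (complete_graph 4) e.
  move=> x0S cS x0A yS yA yx0 ex degx0 degi.
  apply: (minor_contract e_sym x0S cS).
  apply: (IHm _ (A :\: (S :\ x0)) x) => //.
  - suff: #|A :\: (S :\ x0)| < #|A| by lia.
    apply: proper_card; apply/properP; split; first exact: subsetDl.
    by exists y => //; rewrite !inE yx0 yS.
  - exact: contract_sym.
  - exact: contract_irr.
  - move=> i j /and4P[iS _ _ h]; rewrite inE iS /=.
    case/or3P: h => [/eA//|/andP[/eqP->]//|/andP[_ /existsP[s /andP[_ /eA]]]//].
  move=> i ix /set0Pn[j]; rewrite in_nbrs => /and4P[iS _ _ h].
  have [i_S|i_S] := boolP (i \in S).
    by move: iS; rewrite !inE i_S andbT negbK => /eqP ix0;
      rewrite ix0 in ix *; apply: degx0.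
  have Ni : nbrs e i != set0.
    case/or3P: h => [/nbrs0//|/andP[/eqP ix0]|/andP[_ /existsP[s /andP[_
      /nbrs0]]]//].
    by rewrite ix0 x0S in i_S.
  move: (contract_deg e_irr e_sym i_S x0S); rewrite -cards_eq0.
  by apply: deg_loss (degi i i_S ix Ni) (deg3 i ix Ni).
have zx : z != x by rewrite eq_sym; apply: neq.
have [xA zA] : x \in A /\ z \in A by split; [apply: eA exz|apply: (eA z x);
  rewrite e_sym].
have degz : 2 < #|nbrs e z| by apply: deg3 => //; apply: (nbrs0 _ x);
  rewrite e_sym.
have [/existsP[w /and3P[exw ezw degw]]|noW] :=
  boolP [exists w, [&& e x w, e z w & #|nbrs e w| <= 3]]; last first.
  (* contracting xz costs a degree only at vertices of degree at least 4 *)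
  apply: (step [set x; z] x z) => //; rewrite ?inE ?eqxx ?orbT //.
  - apply: (connected_in_radius2 (x := x)) => //; first by rewrite !inE eqxx.
    by move=> y; rewrite !inE => /orP[->//|/eqP->]; rewrite exz orbT.
  - have /set0Pn[j] : nbrs e z :\ x != set0.
      by have := cardsD1 x (nbrs e z); rewrite -cards_eq0; case: (x \in _); lia.
    rewrite !inE => /andP[jx ezj]; exists j.
    have jz : j != z by rewrite eq_sym; apply: neq.
    by apply: (contract_root (s := z)); rewrite // !inE ?eqxx ?orbT // negb_or
      jx.
  move=> i; rewrite !inE negb_or => /andP[_ iz] ix Ni.
  have [cm|cm] := boolP (e i x && e i z).
    apply/orP; right; apply/andP; split.
      by apply: leq_trans (subset_leq_card (subsetIr _ _)) (cards2_le _ _).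
    rewrite ltnNge; apply/negP => d3; move/existsP: noW; apply; exists i.
    by rewrite d3 (e_sym x) (e_sym z) andbT.
  apply/orP; left.
  have [u sub] : exists u, nbrs e i :&: [set x; z] \subset [set u].
    case: (boolP (e i x)) cm => [eix|eix] /= cm; [exists x|exists z];
      apply/subsetP => j; rewrite !inE => /andP[eij /orP[/eqP E|/eqP E]];
      by rewrite E ?eqxx //; move: eij; rewrite E ?(negPf cm) ?(negPf eix).
  by apply: leq_trans (subset_leq_card sub) _; rewrite cards1.
have [wx wz] : w != x /\ w != z by split; rewrite eq_sym; apply: neq.
have wA : w \in A by apply: (eA w x); rewrite e_sym.
have {degw}[w' [Nw w'x w'z]] : exists w', [/\ nbrs e w = [set x; z;
  w'], w' != x & w' != z].
  apply: cards3P; rewrite ?in_nbrs ?(e_sym w) ?(eq_sym x) //.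
  by apply/eqP; rewrite eqn_leq degw deg3 //; apply: (nbrs0 w x); rewrite e_sym.
have eww' : e w w' by rewrite -in_nbrs Nw !inE eqxx orbT.
have eNw i : e w i -> [|| i == x, i == z | i == w'].
  by rewrite -in_nbrs Nw !inE orbA.
have ww' := neq _ _ eww'.
have w'A : w' \in A by apply: (eA w' w); rewrite e_sym.
have degw' : 2 < #|nbrs e w'| by apply: deg3 => //; apply: (nbrs0 _ w);
  rewrite e_sym.
have [/andP[ew'x ew'z]|ndiam] := boolP (e w' x && e w' z).
  by apply: (clique4_minor (a := x) (b := z) (c := w) (d := w')) => //;
    rewrite e_sym.
have [ok|bad] := boolP (~~ e w' z || (3 < #|nbrs e z|)).
  (* w' is not adjacent to some neighbour u of w, so contracting ww' into w'
     trades the neighbour w for u *)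
  have [u [ewu w'u uw']] : exists u, [/\ e w u, ~~ e w' u & u != w'].
    have [ew'z|nz] := boolP (e w' z); last first.
      by exists z; split; rewrite // 1?e_sym // eq_sym.
    by exists x; split; rewrite 1?e_sym 1?eq_sym //; move: ndiam;
      rewrite ew'z andbT e_sym.
  have uw : u != w by rewrite eq_sym; apply: neq.
  apply: (step [set w'; w] w' w) => //; rewrite ?inE ?eqxx ?orbT //.
  - apply: (connected_in_radius2 (x := w')) => //; first by rewrite !inE eqxx.
    by move=> y; rewrite !inE => /orP[->//|/eqP->];
      rewrite (e_sym w') eww' orbT.
  - exists z; apply: contract_edge => //; rewrite !inE negb_and negbK.
      by rewrite (eq_sym x w) (negPf wx) orbF orbN.
    by rewrite (eq_sym z w) (negPf wz) orbF orbN.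
  - move=> _; apply: (leq_trans degw').
    have -> : #|nbrs e w'| = #|u |: (nbrs e w' :\ w)|.
      rewrite cardsU1 !inE (negPf w'u) andbF /= (cardsD1 w (nbrs e w')).
      by rewrite in_nbrs (e_sym w') eww'.
    apply: subset_leq_card; apply/subsetP => i; rewrite in_nbrs !inE.
    case/orP=> [/eqP->|/andP[iw ew'i]].
      by apply: (contract_root (s := w)); rewrite // !inE ?eqxx ?orbT //
        negb_or uw'.
    apply: (contract_root (s := w')); rewrite // !inE ?eqxx //.
    by rewrite negb_or iw andbT eq_sym; apply: neq.
  move=> i; rewrite !inE negb_or => /andP[iw' iw] ix Ni.
  have [cm|cm] := boolP (e i w' && e i w).
    have /andP[eiw' eiw] := cm.
    have iz : i = z.
      by have := eNw i; rewrite e_sym eiw (negPf ix) (negPf iw') orbF /= => /(_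
        isT)/eqP.
    apply/orP; right; apply/andP; split.
      by apply: leq_trans (subset_leq_card (subsetIr _ _)) (cards2_le _ _).
    by move: ok; rewrite iz -iz e_sym eiw' iz.
  apply/orP; left.
  have [v sub] : exists v, nbrs e i :&: [set w'; w] \subset [set v].
    case: (boolP (e i w')) cm => [ei|ei] /= cm; [exists w'|exists w];
      apply/subsetP => j; rewrite !inE => /andP[eij /orP[/eqP E|/eqP E]];
      by rewrite E ?eqxx //; move: eij; rewrite E ?(negPf cm) ?(negPf ei).
  by apply: leq_trans (subset_leq_card sub) _; rewrite cards1.
(* a diamond: z and w are adjacent, of degree 3, with common neighbours x
   and w' *)
move: bad; rewrite negb_or negbK -leqNgt => /andP[ew'z degz3].
move: ndiam; rewrite ew'z andbT => ew'x.
have Nz : nbrs e z = [set x; w; w'].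
  apply/esym/eqP; rewrite eqEcard; apply/andP; split.
    by apply/subsetP => i; rewrite in_nbrs !inE => /orP[/orP[]|]/eqP->;
      rewrite // e_sym.
  rewrite -setUA cardsU1 cards2 ww' !inE eq_sym (negPf wx) eq_sym (negPf w'x)
    /=.
  by apply: leq_trans degz3 _.
have eNz i : e z i -> [|| i == x, i == w | i == w'].
  by rewrite -in_nbrs Nz !inE orbA.
have [degw'4|degw'3] := ltnP 3 #|nbrs e w'|.
  apply: (step [set x; z; w] x z) => //; rewrite ?inE ?eqxx ?orbT //.
  - apply: (connected_in_radius2 (x := x)) => //; first by rewrite !inE eqxx.
    by move=> y; rewrite !inE => /orP[/orP[->//|/eqP->]|/eqP->];
      rewrite ?exz ?exw orbT.
  - exists w'; apply: (contract_root (s := w)); rewrite // !inE ?eqxx ?orbT //.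
    by rewrite !negb_or w'x w'z eq_sym.
  move=> i; rewrite !inE !negb_or => /andP[/andP[_ iz] iw] ix Ni.
  have [->|iw'] := eqVneq i w'.
    apply/orP; right; rewrite degw'4 andbT.
    apply: leq_trans (cards2_le z w); apply: subset_leq_card.
    apply/subsetP => j; rewrite !inE => /andP[ew'j].
    by case/orP=> [/orP[/eqP jx|->//]|->]; rewrite ?orbT //;
      rewrite jx (negPf ew'x) in ew'j.
  apply/orP; left; rewrite -(cards1 x); apply: subset_leq_card.
  apply/subsetP => j; rewrite !inE => /andP[eij].
  case/orP=> [/orP[//|/eqP jz]|/eqP jw].
    by have := eNz i; rewrite -jz e_sym eij (negPf ix) (negPf iw) (negPf iw')
      => /(_ isT).
  by have := eNw i; rewrite -jw e_sym eij (negPf ix) (negPf iz) (negPf iw') =>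
    /(_ isT).
have [u [Nw' uz uw]] : exists u, [/\ nbrs e w' = [set z; w;
  u], u != z & u != w].
  apply: cards3P; rewrite ?in_nbrs //.
  - by apply/eqP; rewrite eqn_leq degw'3 degw'.
  - by rewrite e_sym.
  - by rewrite eq_sym.
have eNw' i : e w' i -> [|| i == z, i == w | i == u].
  by rewrite -in_nbrs Nw' !inE orbA.
have ew'u : e w' u by rewrite -in_nbrs Nw' !inE eqxx orbT.
have w'u := neq _ _ ew'u.
have ux : u != x by apply: contraNneq ew'x => <-.
have [exu|nexu] := boolP (e x u).
  apply: (minor_contract (S := [set u; w']) (x := u)) => //;
    first by rewrite !inE eqxx.
    apply: (connected_in_radius2 (x := u)) => //; first by rewrite !inE eqxx.
    by move=> y; rewrite !inE => /orP[->//|/eqP->]; rewrite (e_sym u) ew'u orbT.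
  have cuj j : e w' j -> j != u -> contract e [set u; w'] u j u.
    move=> ew'j ju; rewrite contract_sym //.
    apply: (contract_root (s := w')); rewrite // !inE ?eqxx ?orbT //.
    by rewrite negb_or ju eq_sym; apply: neq.
  have cij i j : i != w' -> j != w' -> e i j -> contract e [set u; w'] u i j.
    by move=> iw' jw' eij; apply: contract_edge; rewrite // !inE negb_and negbK
      ?(negPf iw') ?(negPf jw') orbF orbN.
  apply: (clique4_minor (a := x) (b := z) (c := w) (d := u)).
  - exact: contract_sym.
  - exact: contract_irr.
  - by apply: cij; rewrite // eq_sym.
  - by apply: cij; rewrite // eq_sym.
  - by apply: cij; rewrite // eq_sym.
  - by apply: cij; rewrite // eq_sym.
  - by apply: cuj; rewrite // eq_sym.
  - by apply: cuj; rewrite 1?e_sym // eq_sym.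
apply: (step [set x; z; w; w'] x z) => //; rewrite ?inE ?eqxx ?orbT //.
- apply: (connected_in_radius2 (x := x)) => //; first by rewrite !inE eqxx.
  move=> y; rewrite !inE => /orP[/orP[/orP[->//|/eqP->]|/eqP->]|/eqP->];
    rewrite ?exz ?exw ?orbT //.
  by apply/orP; right; apply/orP; right; apply/existsP; exists w;
    rewrite !inE eqxx orbT exw.
- exists u; apply: (contract_root (s := w')); rewrite // !inE ?eqxx ?orbT //.
  by rewrite !negb_or ux uz uw eq_sym.
move=> i; rewrite !inE !negb_or => /andP[/andP[/andP[_ iz] iw] iw'] ix Ni.
apply/orP; left.
have sub2 : nbrs e i :&: [set x; z; w; w'] \subset [set if i == u then w' else
  x].
  apply/subsetP => j; rewrite !inE => /andP[eij].
  case/orP=> [/orP[/orP[/eqP jx|/eqP jz]|/eqP jw]|/eqP jw'].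
  - case: (eqVneq i u) => [iu|_]; last by rewrite jx.
    by case/negP: nexu; rewrite e_sym -iu -jx.
  - by have := eNz i; rewrite -jz e_sym eij (negPf ix) (negPf iw) (negPf iw')
      => /(_ isT).
  - by have := eNw i; rewrite -jw e_sym eij (negPf ix) (negPf iz) (negPf iw')
      => /(_ isT).
  - have := eNw' i; rewrite -jw' e_sym eij (negPf iz) (negPf iw) /= => /(_
      isT)->.
    by rewrite jw'.
by apply: leq_trans (subset_leq_card sub2) _; rewrite cards1.
Qed.
Lemma low_degree_vertex (e : rel T) (A : {set T}) : symmetric e -> irreflexive
  e ->
  (forall i j, e i j -> i \in A) -> ~ is_minor (complete_graph 4) e ->
  A != set0 -> exists2 v, v \in A & (#|nbrs e v| <= 2)%N.
Proof.
move=> e_sym e_irr eA noK4 /set0Pn[v vA].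
have [/existsP[u /andP[uA du]]|/existsPn no] :=
  boolP [exists u, (u \in A) && (#|nbrs e u| <= 2)%N]; first by exists u.
have deg i : i \in A -> (2 < #|nbrs e i|)%N.
  by move=> iA; have := no i; rewrite iA /= -ltnNge.
case: noK4; apply: (min_deg_minor (A := A) (x := v)) => //.
  have /card_gt0P[z] := leq_ltn_trans (leq0n 2) (deg v vA).
  by rewrite in_nbrs => vz; exists z.
by move=> i _ /set0Pn[j]; rewrite in_nbrs => /eA/deg.
Qed.

End Contraction.

Local Open Scope ring_scope.

(** * Rounding on one triangle *)

(** The inequalities describe the integer points of the marginal cone of a
    triangle, and the conclusion is its normality. Here [N], [pa], [pb], [pv]
    are the total and the bit counts, [Q], [s], [t] the counts of the pairs
    [ab], [av], [bv], and [k_ij] is how many samples with bits [(i, j)] at [(a,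
    b)] have bit 1 at [v]. All [k_ij] are determined by [k_11], for which the
    inequalities leave a nonempty interval. *)
Lemma triangle_table (N pa pb pv Q s t : int) :
  (0 <= Q) -> (Q <= pa) -> (Q <= pb) -> (pa + pb - N <= Q) ->
  (0 <= s) -> (s <= pa) -> (s <= pv) -> (pa + pv - N <= s) ->
  (0 <= t) -> (t <= pb) -> (t <= pv) -> (pb + pv - N <= t) ->
  (pa + pb + pv - N - Q <= s + t <= pv + Q) ->
  (Q - pb <= s - t <= pa - Q) ->
  exists k11 k10 k01 k00 : int,
  [/\ (0 <= k11 <= Q), (0 <= k10 <= pa - Q), (0 <= k01 <= pb - Q),
      (0 <= k00 <= N - pa - pb + Q) &
      [/\ (k11 + k10 = s), (k11 + k01 = t) &
          (k11 + k10 + k01 + k00 = pv)]].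
Proof.
move=> *.
(* the least value of k_11 for which no k_ij is negative or too large *)
pose w := Order.max (Order.max 0 (s - pa + Q))
                    (Order.max (t - pb + Q) (s + t - pv)).
have [h1 h2 h3 h4] : [/\ (0 <= w), (s - pa + Q <= w), (t - pb + Q <= w) &
  (s + t - pv <= w)] by rewrite /w; split; rewrite !le_max lexx ?orbT.
have h : [\/ (w = 0), (w = s - pa + Q), (w = t - pb + Q) |
  (w = s + t - pv)].
  rewrite /w; case: (leP _ (Order.max _ _)) => _; case: leP => _;
  by [constructor 1|constructor 2|constructor 3|constructor 4].
exists w, (s - w), (t - w), (pv - s - t + w).
by case: h => ?; split; try split; lia.
Qed.

(** The intervals [fs, cs] and [ft, ct] are the floors and ceilings of the real
    masses of the pairs [av] and [bv], while [Q] is the rounded mass of [ab].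
    The triangle inequalities are assumed only at the end of each interval that
    favours them. Of the four choices of ends, one satisfies them all:
    otherwise adding violated inequalities contradicts the conditions on the
    single edges. *)
Lemma int_triangle_round (N pa pb pv Q fs cs ft ct : int) :
  (0 <= Q) -> (Q <= pa) -> (Q <= pb) -> (pa + pb - N <= Q) ->
  (0 <= fs) -> (cs <= pa) -> (cs <= pv) -> (pa + pv - N <= fs) ->
  (0 <= ft) -> (ct <= pb) -> (ct <= pv) -> (pb + pv - N <= ft) ->
  (fs <= cs) -> (cs <= fs + 1) -> (ft <= ct) -> (ct <= ft + 1) ->
  (fs + ft <= pv + Q) -> (pa + pb + pv - N - Q <= cs + ct) ->
  (fs - ct <= pa - Q) -> (Q - pb <= cs - ft) ->
  exists k11 k10 k01 k00 : int,
  [/\ (0 <= k11 <= Q), (0 <= k10 <= pa - Q), (0 <= k01 <= pb - Q),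
      (0 <= k00 <= N - pa - pb + Q) &
      [/\ (fs <= k11 + k10 <= cs), (ft <= k11 + k01 <= ct) &
          (k11 + k10 + k01 + k00 = pv)]].
Proof.
move=> *; suff [s [t [hs ht hst1 hst2]]] : exists s t : int,
    [/\ (fs <= s <= cs), (ft <= t <= ct),
    (pa + pb + pv - N - Q <= s + t <= pv + Q) &
    (Q - pb <= s - t <= pa - Q)].
  have [||||||||||||||k11 [k10 [k01 [k00 [? ? ? ? [? ? ?]]]]]] :=
    @triangle_table N pa pb pv Q s t; try lia.
  by exists k11, k10, k01, k00; split; try split; lia.
have [h1|h1] := boolP ((pa + pb + pv - N - Q <= fs + ft <= pv + Q) &&
    (Q - pb <= fs - ft <= pa - Q)); first by exists fs, ft; split; lia.
have [h2|h2] := boolP ((pa + pb + pv - N - Q <= fs + ct <= pv + Q) &&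
    (Q - pb <= fs - ct <= pa - Q)); first by exists fs, ct; split; lia.
have [h3|h3] := boolP ((pa + pb + pv - N - Q <= cs + ft <= pv + Q) &&
    (Q - pb <= cs - ft <= pa - Q)); first by exists cs, ft; split; lia.
exists cs, ct; split; lia.
Qed.

(** The real masses [y_ijk] of the eight joint values of the bits at [a], [b]
    and [v] serve to derive, by linear arithmetic, the integer inequalities
    assumed in [int_triangle_round]. *)
Lemma real_triangle_round (R : realType) (N pa pb pv Q : int)
    (y111 y110 y101 y100 y011 y010 y001 y000 : R) :
  0 <= y111 -> 0 <= y110 -> 0 <= y101 -> 0 <= y100 ->
  0 <= y011 -> 0 <= y010 -> 0 <= y001 -> 0 <= y000 ->
  y111 + y110 + y101 + y100 + y011 + y010 + y001 + y000 = N%:~R ->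
  y111 + y110 + y101 + y100 = pa%:~R -> y111 + y110 + y011 + y010 = pb%:~R ->
  y111 + y101 + y011 + y001 = pv%:~R -> `|Q%:~R - (y111 + y110)| < 1 ->
  exists k11 k10 k01 k00 : int,
  [/\ (0 <= k11 <= Q), (0 <= k10 <= pa - Q), (0 <= k01 <= pb - Q),
      (0 <= k00 <= N - pa - pb + Q) &
      [/\ `|(k11 + k10)%:~R - (y111 + y101)| < 1,
          `|(k11 + k01)%:~R - (y111 + y011)| < 1 &
          k11 + k10 + k01 + k00 = pv]].
Proof.
move=> ? ? ? ? ? ? ? ? eN ea eb ev; rewrite ltr_norml => /andP[Ql Qu].
set s := y111 + y101; set t := y111 + y011.
have [fs1 fs2] : (Num.floor s)%:~R <= s /\ s < (Num.floor s)%:~R + 1.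
  by have := floor_itv s; rewrite intrD => /andP[].
have [ft1 ft2] : (Num.floor t)%:~R <= t /\ t < (Num.floor t)%:~R + 1.
  by have := floor_itv t; rewrite intrD => /andP[].
have [cs1 cs2] : (Num.ceil s)%:~R - 1 < s /\ s <= (Num.ceil s)%:~R.
  by have := ceil_itv s; rewrite intrD => /andP[].
have [ct1 ct2] : (Num.ceil t)%:~R - 1 < t /\ t <= (Num.ceil t)%:~R.
  by have := ceil_itv t; rewrite intrD => /andP[].
move: (Num.floor s) (Num.floor t) (Num.ceil s) (Num.ceil t)
  fs1 fs2 ft1 ft2 cs1 cs2 ct1 ct2 => fs ft cs ct; rewrite /s /t => {s t} *.
(* a real inequality off by less than 1 is exact between integers *)
have intle (a b : int) : (a%:~R < b%:~R + 1 :> R) -> a <= b.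
  by rewrite -ltzD1 -(ltr_int R) intrD.
have [||||||||||||||||||||k11 [k10 [k01 [k00 [h1 h2 h3 h4 [h5 h6 h7]]]]]] :=
  @int_triangle_round N pa pb pv Q fs cs ft ct;
  try (apply: intle; rewrite ?intrD ?intrN; lra).
exists k11, k10, k01, k00; split=> //; split=> //.
  by case/andP: h5; rewrite -!(ler_int R) ltr_norml => ? ?; lra.
by case/andP: h6; rewrite -!(ler_int R) ltr_norml => ? ?; lra.
Qed.

(** * Masses of events *)

Section Mass.
Variables (R : realType) (W : finType) (x : W -> R).
Hypothesis x_ge0 : forall w, 0 <= x w.

Definition mass (P : pred W) : R := \sum_(w | P w) x w.

Lemma mass_ge0 P : 0 <= mass P.
Proof. by apply: sumr_ge0. Qed.

Lemma eq_mass (P D : pred W) : P =1 D -> mass P = mass D.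
Proof. exact: eq_bigl. Qed.

Lemma mass_indicator (P : pred W) :
  mass P = \sum_w x w * (P w)%:R.
Proof.
rewrite /mass big_mkcond; apply: eq_bigr => w _.
by case: (P w); rewrite ?mulr1 ?mulr0.
Qed.

Lemma mass_literal (P : pred W) beta :
  mass (fun w => P w == beta) =
  if beta then mass P else mass predT - mass P.
Proof.
by case: beta; rewrite !mass_indicator -?sumrB; apply: eq_bigr => w _ /=;
  case: (P w) => /=; lra.
Qed.

Lemma mass_literal2 (P D : pred W)
    beta gamma :
  let PD := mass (fun w => P w && D w) in
  mass (fun w => (P w == beta) && (D w == gamma)) =
  match beta, gamma with
  | true, true => PD
  | true, false => mass P - PD
  | false, true => mass D - PD
  | false, false => mass predT - mass P - mass D + PD
  end.
Proof.
by case: beta; case: gamma; rewrite /= !mass_indicator -?sumrB -?big_split;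
  apply: eq_bigr => w _ /=; case: (P w); case: (D w) => /=; lra.
Qed.

(** [Q] is the rounded mass of [a && b], and [k_ij] is how many of the samples
    with values [(i, j)] of [(a, b)] are to satisfy [v]. *)
Lemma round_event (a b v : pred W) (N pa pb pv Q : nat) :
  mass predT = N%:R -> mass a = pa%:R -> mass b = pb%:R -> mass v = pv%:R ->
  `|Q%:R - mass (fun w => a w && b w)| < 1 ->
  exists k11 k10 k01 k00 : nat,
  [/\ [/\ (k11 <= Q)%N, (k10 + Q <= pa)%N, (k01 + Q <= pb)%N &
       (k00 + pa + pb <= N + Q)%N],
      `|(k11 + k10)%:R - mass (fun w => a w && v w)| < 1,
      `|(k11 + k01)%:R - mass (fun w => b w && v w)| < 1 &
      (k11 + k10 + k01 + k00 = pv)%N].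
Proof.
pose y (i j k : bool) := mass (fun w => [&& a w == i, b w == j & v w == k]).
have y0 i j k : 0 <= y i j k by apply: mass_ge0.
have split8 P : mass P = \sum_(i : bool) \sum_(j : bool) \sum_(k : bool)
    mass (fun w => P w && [&& a w == i, b w == j & v w == k]).
  rewrite /mass (partition_big a predT) //=; apply: eq_bigr => i _.
  rewrite (partition_big b predT) //=; apply: eq_bigr => j _.
  rewrite (partition_big v predT) //=; apply: eq_bigr => k _.
  by apply: eq_bigl => w; rewrite -!andbA.
have E P (f : bool -> bool -> bool -> bool) :
    (forall w, P w = f (a w) (b w) (v w)) ->
    mass P = \sum_(i : bool) \sum_(j : bool) \sum_(k : bool)
      (if f i j k then y i j k else 0).
  move=> Pf; rewrite split8; do 3 (apply: eq_bigr => ? _).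
  case: ifP => [fT|fF].
    apply: eq_mass => w; rewrite Pf; apply: andb_idl.
    by case/and3P=> /eqP-> /eqP-> /eqP->.
  rewrite /mass big_pred0 // => w; apply/negP => /andP[].
  by rewrite Pf => fw /and3P[/eqP ai /eqP bj /eqP vk];
    rewrite -ai -bj -vk fw in fF.
(* every mass in the statement is a sum of some of the y_ijk *)
rewrite (E predT (fun _ _ _ => true)) // (E a (fun i _ _ => i)) //.
rewrite (E b (fun _ j _ => j)) // (E v (fun _ _ k => k)) //.
rewrite (E _ (fun i j _ => i && j)) // (E _ (fun i _ k => i && k)) //.
rewrite (E (fun w => b w && v w) (fun _ j k => j && k)) //.
rewrite !big_bool /= !addr0 !addrA !pmulrn => eN ea eb ev hQ.
have [k11 [k10 [k01 [k00 []]]]] := @real_triangle_round R N pa pb pv Q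
  _ _ _ _ _ _ _ _ (y0 true true true) (y0 true true false)
  (y0 true false true) (y0 true false false) (y0 false true true)
  (y0 false true false) (y0 false false true) (y0 false false false) eN ea eb
    ev hQ.
move=> h1 h2 h3 h4 [h5 h6 h7].
exists `|k11|%N, `|k10|%N, `|k01|%N, `|k00|%N.
have cast (i j : int) : 0 <= i -> 0 <= j -> (`|i| + `|j|)%:R = (i + j)%:~R :> R.
  by move=> i0 j0; rewrite pmulrn; congr (_%:~R); lia.
split; last by lia.
- by split; lia.
- by move: h5; rewrite cast; lra || lia.
- by move: h6; rewrite cast; lra || lia.
Qed.
End Mass.

Lemma mass_count (R : realType) (W : finType) (l : seq W) (P : pred W) :
  mass (fun w => (count_mem w l)%:R : R) P = (count P l)%:R.
Proof.
rewrite /mass -natr_sum; congr _%:R; elim: l => [|c l IHl] /=;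
  first by rewrite big1.
rewrite big_split IHl /=; congr (_ + _)%N.
case Pc: (P c).
  by rewrite (bigD1 c) //= eqxx big1 // => w /andP[_ /negPf wc];
    rewrite eq_sym wc.
by rewrite big1 // => w Pw; case: eqVneq => // cw; rewrite cw Pw in Pc.
Qed.

(** * Rounding a weight to a sequence of samples *)

Section Samples.
Variable S : Type.

Lemma count_split (P D : pred S) s :
  count P s = (count (fun c => P c && D c) s +
               count (fun c => P c && ~~ D c) s)%N.
Proof. by elim: s => //= c s ->; case: (P c); case: (D c) => /=; lia. Qed.

(** The marks will be the bits of the samples at a new vertex, and [f] tells
    the types of the samples. *)
Lemma mark_samples (L : eqType) (f : S -> L) (k : L -> nat) s :
  (forall l, (k l <= count (fun c => f c == l) s)%N) ->
  exists m : seq (S * bool), map fst m = s /\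
    forall l, count (fun z => (f z.1 == l) && z.2) m = k l.
Proof.
elim: s k => [|c s IHs] k ks.
  by exists [::]; split=> // l; apply/esym/eqP; rewrite -leqn0 ks.
have [|m [ms mk]] := IHs (fun l => (k l - (f c == l))%N).
  by move=> l; have := ks l; rewrite /=; lia.
exists ((c, (0 < k (f c))%N) :: m); split=> [|l] /=; first by rewrite ms.
by rewrite mk; case: eqVneq => [<-|]; case: (k _) => //=; lia.
Qed.
End Samples.

Section Round.
Variables (R : realType) (W : finType) (x : W -> R).
Hypothesis x_ge0 : forall w, 0 <= x w.
Variable T : finType.
Notation sample := {ffun T -> bool}.

Definition set_bit (v : T) (c : sample) (beta : bool) : sample :=
  [ffun i => if i == v then beta else c i].

Definition bit_free (v : T) (P : pred sample) :=
  forall c beta, P (set_bit v c beta) = P c.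

(** The bit at [v] of each sample is overwritten, so that its joint counts with
    the events [a'] and [b'] become roundings of the real masses. The events
    [a] and [b] need not be bits: this covers vertices with fewer than two
    neighbours, by [a = b] or by trivial events. *)
Lemma extend_samples (v : T) (bv a b : pred W) (a' b' : pred sample) s (pv :
  nat) :
  bit_free v a' -> bit_free v b' ->
  mass x predT = (size s)%:R -> mass x bv = pv%:R ->
  mass x a = (count a' s)%:R -> mass x b = (count b' s)%:R ->
  `|(count (fun c => a' c && b' c) s)%:R - mass x (fun w => a w && b w)| < 1 ->
  exists s' : seq sample,
  [/\ forall P, bit_free v P -> count P s' = count P s,
      count (fun c : sample => c v) s' = pv,
      `|(count (fun c : sample => a' c && c v) s')%:R - mass x (fun w => a w &&
        bv w)| < 1 &
      `|(count (fun c : sample => b' c && c v) s')%:R - mass x (fun w => b w &&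
        bv w)| < 1].
Proof.
move=> a'v b'v hN hv ha hb hQ.
have [k11 [k10 [k01 [k00 [[h11 h10 h01 h00] hs ht hp]]]]] :=
  round_event x_ge0 hN ha hb hv hQ.
pose f c := (a' c, b' c).
pose k (l : bool * bool) := match l with
  | (true, true) => k11 | (true, false) => k10
  | (false, true) => k01 | (false, false) => k00 end.
have cntf i j t : count (fun c => f c == (i, j)) t =
    count (fun c => (a' c == i) && (b' c == j)) t by apply: eq_count.
have [|m [ms mk]] := @mark_samples _ _ f k s.
  have c1 := count_split a' b' s.
  have c2 := count_split b' a' s.
  have c3 : size s = (count a' s + count (fun c => ~~ a' c) s)%N.
    by rewrite -(count_predC a').
  have c4 := count_split (fun c => ~~ a' c) b' s.
  have c5 : count (fun c => b' c && a' c) s = count (fun c => a' c && b' c) s.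
    by apply: eq_count => c; rewrite andbC.
  have c6 : count (fun c => ~~ a' c && b' c) s = count (fun c => b' c && ~~ a'
    c) s.
    by apply: eq_count => c; rewrite andbC.
  case=> [[] []]; rewrite cntf /k.
  - apply: leq_trans h11 _; rewrite (@eq_count _ _ (fun c => a' c && b' c)) //
      => c.
    by rewrite !eqb_id.
  - rewrite (@eq_count _ _ (fun c => a' c && ~~ b' c)) => [|c]; first lia.
    by rewrite eqb_id eqbF_neg.
  - rewrite (@eq_count _ _ (fun c => b' c && ~~ a' c)) => [|c]; first lia.
    by rewrite eqb_id eqbF_neg andbC.
  - rewrite (@eq_count _ _ (fun c => ~~ a' c && ~~ b' c)) => [|c]; first lia.
    by rewrite !eqbF_neg.
have setv c beta : set_bit v c beta v = beta by rewrite ffunE eqxx.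
have mkE i j : count (fun z => [&& a' z.1 == i, b' z.1 == j & z.2]) m = k (i,
  j).
  by rewrite -mk; apply: eq_count => z; rewrite /f xpair_eqE andbA.
have [m11 m10 m01 m00] :=
  And4 (mkE true true) (mkE true false) (mkE false true) (mkE false false).
have Ea : count (fun z => a' z.1 && z.2) m = (k11 + k10)%N.
  rewrite (count_split _ (fun z => b' z.1)) -[k11]m11 -[k10]m10.
  by congr (_ + _)%N; apply: eq_count => z; case: (a' _); case: (b' _);
    case: z.2.
have Eb : count (fun z => b' z.1 && z.2) m = (k11 + k01)%N.
  rewrite (count_split _ (fun z => a' z.1)) -[k11]m11 -[k01]m01.
  by congr (_ + _)%N; apply: eq_count => z; case: (a' _); case: (b' _);
    case: z.2.
have Ev : count (fun z : sample * bool => z.2) m = pv.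
  rewrite -hp (count_split _ (fun z => a' z.1)).
  rewrite (count_split (fun z => z.2 && ~~ _) (fun z => b' z.1)).
  rewrite -addnA -Ea -[k01]m01 -[k00]m00.
  by congr (_ + (_ + _))%N; apply: eq_count => -[c []] /=;
    case: (a' c) => //=; case: (b' c).
exists [seq set_bit v z.1 z.2 | z <- m]; split.
- move=> P Pv; rewrite count_map -ms count_map.
  by apply: eq_count => z /=; rewrite Pv.
- by rewrite count_map -Ev; apply: eq_count => z /=; rewrite setv.
- rewrite count_map (@eq_count _ _ (fun z => a' z.1 && z.2)) ?Ea // => z /=.
  by rewrite setv a'v.
- rewrite count_map (@eq_count _ _ (fun z => b' z.1 && z.2)) ?Eb // => z /=.
  by rewrite setv b'v.
Qed.

(** Vertices outside [A] have been removed: they have no edge, and the samples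
    are not constrained there. *)
Theorem round_samples (bit : T -> pred W) (e : rel T) (A : {set T})
    (N : nat) (p : T -> nat) :
  symmetric e -> irreflexive e -> (forall i j, e i j -> i \in A) ->
  ~ is_minor (complete_graph 4) e ->
  mass x predT = N%:R -> (forall i, i \in A -> mass x (bit i) = (p i)%:R) ->
  exists s : seq sample,
  [/\ size s = N, forall i, i \in A -> count (fun c : sample => c i) s = p i &
      forall i j, e i j ->
        `|(count (fun c : sample => c i && c j) s)%:R
          - mass x (fun w => bit i w && bit j w)| < 1].
Proof.
have [m] := ubnP #|A|; elim: m e A => // m IHm e A Am e_sym e_irr eA noK4 hN hp.
have [A0|/(low_degree_vertex e_sym e_irr eA noK4)[v vA degv]] := eqVneq A set0.
  exists (nseq N [ffun=> false]); split=> [|i|i j /eA]; rewrite ?size_nseq //;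
  by rewrite A0 inE.
have subA i : i \in A :\ v -> i \in A by rewrite !inE => /andP[].
have AvA : (#|A :\ v| < m)%N.
  by move: Am; rewrite (cardsD1 v A) vA; lia.
have freei i : i != v -> bit_free v (fun c : sample => c i).
  by move=> iv c beta; rewrite ffunE (negPf iv).
have free2 i j : i != v -> j != v -> bit_free v (fun c : sample => c i && c j).
  by move=> iv jv c beta; rewrite !ffunE (negPf iv) (negPf jv).
have hpv i : i \in A :\ v -> mass x (bit i) = (p i)%:R by move=> /subA/hp.
have [N0|/set0Pn[a]] := eqVneq (nbrs e v) set0.
  have ev i : e v i = false by rewrite -in_nbrs N0 inE.
  have [|s [sN sp se]] := IHm e (A :\ v) AvA e_sym e_irr _ noK4 hN hpv.
    by move=> i j eij; rewrite !inE (eA i j) // andbT;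
      apply: contraTneq eij => ->; rewrite ev.
  have [|||||||s' [sP sv _ _]] := @extend_samples v (bit v) predT predT predT
    predT s (p v).
  + by [].
  + by [].
  + by rewrite sN.
  + by apply: hp.
  + by rewrite hN count_predT sN.
  + by rewrite hN count_predT sN.
  + by rewrite /= count_predT hN sN subrr normr0.
  exists s'; split.
  - by rewrite -sN -!count_predT sP.
  - move=> i iA; have [->//|iv] := eqVneq i v.
    by rewrite sP ?sp ?inE ?iv //; apply: freei.
  - move=> i j eij.
    have iv : i != v by apply: contraTneq eij => ->; rewrite ev.
    have jv : j != v by apply: contraTneq eij => ->; rewrite e_sym ev.
    by rewrite sP ?se //; apply: free2.
rewrite in_nbrs => eva.
(* if v has the single neighbour a, then b = a *)
have [b Nv] : exists b, nbrs e v = [set a; b].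
  have ain : a \in nbrs e v by rewrite in_nbrs.
  move: degv; rewrite (cardsD1 a) ain ltnS.
  case: (posnP #|nbrs e v :\ a|) => [/eqP|].
    rewrite cards_eq0 => /eqP va0 _; exists a; rewrite setUid.
    by rewrite -(setD1K ain) va0 setU0.
  move=> c0 c1; have /eqP/cards1P[b vb] : #|nbrs e v :\ a| = 1%N by lia.
  by exists b; rewrite -(setD1K ain) vb.
have neq i j : e i j -> i != j by apply: contraTneq => ->; rewrite e_irr.
have evb : e v b by rewrite -in_nbrs Nv !inE eqxx orbT.
have [va vb] := (neq _ _ eva, neq _ _ evb).
have aA : a \in A by apply: (eA a v); rewrite e_sym.
have bA : b \in A by apply: (eA b v); rewrite e_sym.
pose e' := contract e [set a; v] a.
have old i j : i != v -> j != v -> e i j -> e' i j.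
  by move=> iv jv eij; apply: contract_edge; rewrite // !inE negb_and negbK
      ?(negPf iv) ?(negPf jv) orbF orbN.
have [||s [sN sp se]] := IHm e' (A :\ v) AvA (contract_sym _ _ e_sym)
    (contract_irr _ _ _) _ _ hN hpv.
- move=> i j /and4P[iS _ _ h]; rewrite !inE.
  have -> : i != v.
    by apply: contraNneq iS => ->; rewrite !inE va eqxx orbT.
  by case/or3P: h => [/eA//|/andP[/eqP->]//|/andP[_ /existsP[k /andP[_ /eA]]]].
- move=> K4; apply: noK4; apply: (minor_contract _ _ _ K4);
    rewrite ?inE ?eqxx //.
  apply: (connected_in_radius2 (x := a)) => //; first by rewrite !inE eqxx.
  by move=> y; rewrite !inE => /orP[->//|/eqP->]; rewrite (e_sym a) eva orbT.
have [|||||||s' [sP sv sa sb]] := @extend_samples v (bit v) (bit a) (bit b)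
   (fun c : sample => c a) (fun c : sample => c b) s (p v).
- by apply: freei; rewrite eq_sym.
- by apply: freei; rewrite eq_sym.
- by rewrite sN.
- exact: hp.
- by rewrite sp ?hp // !inE eq_sym va.
- by rewrite sp ?hp // !inE eq_sym vb.
- (* ab is an edge of the contracted graph, unless a = b, when the mass of the
     pair is the integer mass of a *)
  have [<-|ab] := eqVneq a b.
    rewrite (@eq_count _ _ (fun c : sample => c a)) => [|c];
      last by rewrite andbb.
    rewrite (@eq_mass _ _ _ _ (bit a)) => [|w]; last by rewrite andbb.
    by rewrite sp ?hp ?subrr ?normr0 // !inE eq_sym va.
  apply: se; apply: (contract_root (s := v)); rewrite // !inE ?eqxx ?orbT //.
  by rewrite negb_or eq_sym ab eq_sym.
exists s'; split.
- by rewrite -sN -!count_predT sP.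
- move=> i iA; have [->//|iv] := eqVneq i v.
  by rewrite sP ?sp ?inE ?iv //; apply: freei.
have evj j : e v j ->
    `|(count (fun c : sample => c j && c v) s')%:R
      - mass x (fun w => bit j w && bit v w)| < 1.
  by rewrite -in_nbrs Nv !inE => /orP[]/eqP->.
move=> i j eij; have [iv|iv] := eqVneq i v.
  rewrite iv in eij *; rewrite (eq_count (a2 := fun c : sample => c j && c v))
    => [|c].
    by rewrite (@eq_mass _ _ _ _ (fun w => bit j w && bit v w)) ?evj // => w;
      rewrite andbC.
  by rewrite andbC.
have [jv|jv] := eqVneq j v; first by rewrite jv evj // e_sym -jv.
by rewrite sP ?se //; [apply: old | apply: free2].
Qed.
End Round.

(** * Orthogonal arrays *)

Section OrthogonalArray.
Variables (R : realType) (W : finType) (y : W -> R).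

(** Let [w] be a run, and [A c] the number of factors in which the run [c]
    agrees with [w]. The hypotheses give the sums 4, 8 and 20 of 1, [A] and
    [A ^ 2] over the four runs, so [(A - 1) (A - 2)] has the sum 20 - 24 + 8 = 4.
    All its values are nonnegative, but the value at [w] is 6. *)
Lemma no_orthogonal_array (b : 'I_4 -> pred W) :
  (forall w, y w \is a Num.nat) -> mass y predT = 4%:R ->
  (forall s beta, mass y (fun w => b s w == beta) = 2%:R) ->
  (forall s t beta gamma, s != t ->
     mass y (fun w => (b s w == beta) && (b t w == gamma)) = 1) ->
  False.
Proof.
move=> y_nat y4 y2 y1.
have y_ge0 w : 0 <= y w by apply: natr_ge0.
have [w yw] : exists w, y w != 0.
  case: (pickP (fun w => y w != 0)) => [w yw|y0]; first by exists w.
  move: y4; rewrite /mass big1 => [/eqP|w _]; last by apply/eqP/negbFE/y0.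
  by rewrite eq_sym pnatr_eq0.
have yw1 : 1 <= y w.
  by have /natrP[k yk] := y_nat w; move: yw; rewrite yk pnatr_eq0 ler1n lt0n.
pose agr s c := b s c == b s w.
pose A c := (\sum_(s < 4) agr s c)%N.
have S1 : \sum_c y c * (A c)%:R = 8%:R.
  transitivity (\sum_(s < 4) mass y (agr s)).
    under eq_bigr do rewrite /A natr_sum mulr_sumr.
    by rewrite exchange_big; apply: eq_bigr => s _; rewrite mass_indicator.
  rewrite (eq_bigr (fun _ => 2%:R)) => [|s _]; last exact: y2.
  by rewrite sumr_const card_ord; lra.
have S2 : \sum_c y c * (A c * A c)%:R = 20%:R.
  transitivity (\sum_(s < 4) \sum_(t < 4) mass y (fun c => agr s c && agr t c)).
    under eq_bigr do rewrite /A natrM natr_sum mulr_suml mulr_sumr.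
    rewrite exchange_big; apply: eq_bigr => s _.
    under eq_bigr do rewrite mulr_sumr mulr_sumr.
    rewrite exchange_big; apply: eq_bigr => t _; rewrite mass_indicator.
    by apply: eq_bigr => c _; rewrite -natrM mulnb.
  rewrite (eq_bigr (fun _ => 5%:R)) => [|s _].
    by rewrite sumr_const card_ord; lra.
  rewrite (bigD1 s) //= (@eq_mass _ _ _ _ (agr s)) => [|c];
    last by rewrite andbb.
  rewrite y2 (eq_bigr (fun _ => 1)) => [|t ts]; last by apply: y1;
    rewrite eq_sym.
  by rewrite sumr_const cardC1 card_ord /=; lra.
pose q (k : nat) : R := (k * k)%:R - 3%:R * k%:R + 2%:R.
have q0 k : 0 <= q k.
  rewrite /q; case: k => [|[|k]]; rewrite ?mulr0 ?mulr1 //; first by lra.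
    by rewrite muln1; lra.
  rewrite -natrM -addrAC -natrD subr_ge0 ler_nat; lia.
have Sq : \sum_c y c * q (A c) = 4%:R.
  under eq_bigr => c _.
    rewrite /q mulrDr mulrBr mulrCA; over.
  rewrite big_split sumrB -mulr_sumr S1 S2 /= -mulr_suml.
  have -> : \sum_i y i = 4%:R by apply: y4.
  lra.
have Aw : A w = 4.
  by rewrite /A (eq_bigr (fun _ => 1%N)) ?sum1_card ?card_ord // => s _;
    rewrite /agr eqxx.
have : y w * q (A w) <= 4%:R.
  by rewrite -Sq (bigD1 w) //= lerDl; apply: sumr_ge0 => c _; apply: mulr_ge0.
by rewrite Aw /q => ?; lra.
Qed.
End OrthogonalArray.

Section Cube.
(** Products of [bool] rather than finite functions, so that sums over all
    points expand to explicit terms. *)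
Definition cube : finType := (bool * bool * bool * bool)%type.
Definition cube_bit (s : 'I_4) (z : cube) : bool :=
  nth false [:: z.1.1.1; z.1.1.2; z.1.2; z.2] s.

Lemma card_cube (P : pred cube) : #|P| =
  (\sum_(a : bool) \sum_(b : bool) \sum_(c : bool) \sum_(d : bool)
     P (a, b, c, d))%N.
Proof.
rewrite -sum1_card big_mkcond !pair_bigA /=.
by apply: eq_bigr => -[[[a b] c] d] _; rewrite unfold_in /=; case: (P _).
Qed.

(** At least two of the four bits are free. *)
Lemma dvdn_card_cube (f : bool -> bool -> bool) s t :
  (4 %| #|[pred z | f (cube_bit s z) (cube_bit t z)]|)%N.
Proof.
rewrite card_cube !big_bool /cube_bit.
case: s t => [[|[|[|[|s]]]] //= _] [[|[|[|[|t]]]] //= _];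
by case: (f true true); case: (f true false); case: (f false true);
  case: (f false false).
Qed.

Lemma card_cube1 s beta : #|[pred z | cube_bit s z == beta]| = 8.
Proof.
rewrite card_cube !big_bool /cube_bit.
by case: s => [[|[|[|[|s]]]] //= _]; case: beta.
Qed.

Lemma card_cube2 s t beta gamma : s != t ->
  #|[pred z | (cube_bit s z == beta) && (cube_bit t z == gamma)]| = 4.
Proof.
rewrite card_cube !big_bool /cube_bit.
by case: s t => [[|[|[|[|s]]]] //= _] [[|[|[|[|t]]]] //= _]; case: beta;
  case: gamma.
Qed.
End Cube.

(** * Marginals as masses of events *)

Section Cells.
Variables (R : realType) (n : nat).

Lemma marginal_mapE (r : 'I_n -> nat) (Delta : {set {set 'I_n}})
    (x : {ffun cell r -> R^o}) (F : {F : {set 'I_n} | F \in Delta})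
    (g : face_cell r (val F)) :
  marginal_map Delta x (existT _ F g : marginal_index r Delta) =
  mass x (fun c => restrict (val F) c == g).
Proof.
rewrite /marginal_map sum_ffunE /mass [RHS]big_mkcond; apply: eq_bigr => c _.
rewrite ffunE sum_ffunE (bigD1 F) //= big1 => [|G GF]; last first.
  by rewrite ffunE; case: eqP => // E; case/eqP: GF; case: E => <-.
rewrite addr0 ffunE /marginal_cell.
rewrite -tag_eqE /tag_eq /= eqxx tagged_asE eq_sym.
by case: eqP; rewrite /= ?scaler0 // => _; rewrite /GRing.scale /= mulr1.
Qed.

Notation bcell := (cell (fun _ : 'I_n => 2%N)).

Definition bit (i : 'I_n) (c : bcell) : bool := c i == 1%N :> nat.

Definition agree (F : {set 'I_n}) (c0 c : bcell) : bool :=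
  [forall i in F, bit i c == bit i c0].

Definition cell_of (b : 'I_n -> bool) : bcell :=
  [ffun i => if b i then ord_max else ord0 : 'I_2].

Lemma bit_cell_of b i : bit i (cell_of b) = b i.
Proof. by rewrite /bit ffunE; case: (b i). Qed.

Lemma ord2_eq (u v : 'I_2) : (u == v) = ((u == 1%N :> nat) == (v == 1%N :>
  nat)).
Proof. by case: u v => [[|[|u]] hu] // [[|[|v]] hv]. Qed.

Lemma restrict_eq (F : {set 'I_n}) (c0 c : bcell) :
  (restrict F c == restrict F c0) = agree F c0 c.
Proof.
apply/eqP/forallP => [E i|ag].
  apply/implyP => iF; have /ffunP/(_ (exist _ i iF)) := E.
  by rewrite !ffunE /= /bit => ->.
apply/ffunP => -[i iF]; rewrite !ffunE /=; apply/eqP; rewrite ord2_eq.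
by have := ag i; rewrite iF.
Qed.

Lemma restrict_surj (F : {set 'I_n}) (g : face_cell (fun=> 2%N) F) :
  exists c0 : bcell, restrict F c0 = g.
Proof.
exists [ffun i => if insub i is Some f then g f else ord0 : 'I_2].
apply/ffunP => -[i iF]; rewrite !ffunE /=.
by case: insubP => [f _ fi|]; [congr (fun_of_fin g _);
  apply: val_inj | rewrite iF].
Qed.
End Cells.

Lemma eq_nat_close (R : realType) (k q : nat) : `|k%:R - q%:R| < 1 :> R -> k =
  q.
Proof.
rewrite ltr_norml => /andP[h1 h2]; case: (ltngtP k q) => // kq.
  have : (k.+1)%:R <= q%:R :> R by rewrite ler_nat.
  by rewrite -natr1 => {kq} ?; exfalso; lra.
have : (q.+1)%:R <= k%:R :> R by rewrite ler_nat.
by rewrite -natr1 => {kq} ?; exfalso; lra.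
Qed.

Section Marginals.
Variables (R : realType) (n : nat) (e : rel 'I_n).
Notation bcell := (cell (fun _ : 'I_n => 2%N)).
Notation table := {ffun bcell -> R^o}.
Notation Delta := (graph_complex e).

Definition face_index (F : {set 'I_n}) (FD : F \in Delta) (c0 : bcell) :
    marginal_index (fun=> 2%N) Delta :=
  existT _ (exist _ F FD) (restrict F c0).

Lemma marginal_face (x : table) F (FD : F \in Delta) c0 :
  marginal_map Delta x (face_index FD c0) = mass x (agree F c0).
Proof. by rewrite marginal_mapE; apply: eq_mass => c; rewrite restrict_eq. Qed.

Lemma face_indexP (k : marginal_index (fun=> 2%N) Delta) :
  exists F (FD : F \in Delta) c0, k = face_index FD c0.
Proof.
case: k => [[F FD] g]; have [c0 <-] := restrict_surj g.
by exists F, FD, c0.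
Qed.

Lemma marginal_map_inj_agree (x y : table) F c0 : F \in Delta ->
  marginal_map Delta x = marginal_map Delta y ->
  mass x (agree F c0) = mass y (agree F c0).
Proof. by move=> FD xy; rewrite -!(marginal_face _ FD) xy. Qed.

Lemma face0 : set0 \in Delta. Proof. by rewrite inE eqxx. Qed.

Lemma face1 i : [set i] \in Delta.
Proof. by rewrite inE; apply/or3P/Or32/existsP; exists i. Qed.

Lemma face2 i j : e i j -> [set i; j] \in Delta.
Proof.
move=> eij; rewrite inE; apply/or3P/Or33/existsP; exists i.
by apply/existsP; exists j; rewrite eij /=.
Qed.

Lemma agree0 c0 : @agree n set0 c0 =1 predT.
Proof. by move=> c; apply/forallP => i; rewrite inE. Qed.

Lemma agree1 i c0 : agree [set i] c0 =1 (fun c : bcell => bit i c == bit i c0).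
Proof.
move=> c; apply/forallP/idP => [/(_ i)|h j]; rewrite inE ?eqxx //.
by apply/implyP => /eqP->.
Qed.

Lemma agree2 i j c0 : agree [set i; j] c0 =1
  (fun c : bcell => (bit i c == bit i c0) && (bit j c == bit j c0)).
Proof.
move=> c; apply/forallP/andP => [h|[hi hj] k].
  by split; [have := h i | have := h j]; rewrite !inE eqxx ?orbT.
by rewrite !inE; apply/implyP => /orP[]/eqP->.
Qed.

(** The bit masses and the masses of pairs of ones determine the masses of all
    joint values on a face. *)
Lemma eq_marginal_map (x y : table) : mass x predT = mass y predT ->
  (forall i, mass x (bit i) = mass y (bit i)) ->
  (forall i j, e i j -> mass x (fun c : bcell => bit i c && bit j c) =
                        mass y (fun c : bcell => bit i c && bit j c)) ->
  marginal_map Delta x = marginal_map Delta y.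
Proof.
move=> eN e1 e2; apply/ffunP => k; have [F [FD [c0 ->]]] := face_indexP k.
rewrite !marginal_face; move: FD; rewrite inE => /or3P[/eqP->|/existsP[i
  /eqP->]|].
- by rewrite !(eq_mass _ (agree0 c0)).
- by rewrite !(eq_mass _ (agree1 i c0)) !mass_literal eN e1.
case/existsP=> i /existsP[j /andP[eij /eqP->]].
by rewrite !(eq_mass _ (agree2 i j c0)) !mass_literal2 eN !e1 e2.
Qed.

(** * Normality of graphs without a K_4 minor *)

Lemma normal_of_no_K4_minor : symmetric e -> irreflexive e ->
  ~ is_minor (complete_graph 4) e -> marginal_normal R (fun=> 2%N) Delta.
Proof.
move=> e_sym e_irr noK4; apply/seteqP; split=> y.
  case=> -[x /= x0 <-] yint; pose c1 := cell_of (fun _ : 'I_n => true).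
  have c1E i : bit i c1 = true by rewrite bit_cell_of.
  have xnat F : F \in Delta -> mass x (agree F c1) \is a Num.nat.
    move=> FD; rewrite -intrEge0; last exact: mass_ge0.
    by rewrite -(marginal_face _ FD); apply: yint.
  have xN : mass x predT \is a Num.nat.
    by rewrite -(eq_mass _ (agree0 c1)); apply/xnat/face0.
  have x1 i : mass x (bit i) \is a Num.nat.
    by have := xnat _ (face1 i); rewrite (eq_mass _ (agree1 i c1)) mass_literal
      c1E.
  have x2 i j : e i j -> mass x (fun c : bcell => bit i c && bit j c) \is a
    Num.nat.
    by move/face2/xnat; rewrite (eq_mass _ (agree2 i j c1)) mass_literal2 !c1E.
  have [||||s [sN s1 s2]] := @round_samples R _ x x0 _ (@bit n) e setT
    (Num.trunc (mass x predT)) (fun i => Num.trunc (mass x (bit i))) e_sym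
      e_irr.
  - by move=> i j; rewrite inE.
  - exact: noK4.
  - by rewrite truncnK.
  - by move=> i _; rewrite truncnK.
  pose l := [seq cell_of c | c : {ffun 'I_n -> bool} <- s].
  pose z : table := [ffun c => (count_mem c l)%:R].
  have zE P : mass z P = (count P l)%:R.
    by rewrite -mass_count; apply: eq_bigr => c _; rewrite ffunE.
  exists z => [c /=|]; first by rewrite ffunE natr_nat.
  apply: eq_marginal_map => [|i|i j eij].
  - by rewrite zE count_predT size_map sN truncnK.
  - rewrite zE count_map (eq_count (a2 := fun c : {ffun 'I_n -> bool} => c i))
      => [|c /=].
      by rewrite s1 ?truncnK ?inE.
    by rewrite bit_cell_of.
  rewrite zE count_map (eq_count (a2 := fun c : {ffun 'I_n -> bool} => c i && c
    j)) => [|c /=].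
    have := s2 i j eij; have /natrP[k ->] := x2 i j eij.
    by move/eq_nat_close->.
  by rewrite !bit_cell_of.
case=> x /= xnat <-; split.
  by exists x => //= c; apply: natr_ge0.
move=> k; have [F [FD [c0 ->]]] := face_indexP k; rewrite marginal_face.
by apply: rpred_sum => c _; apply: intr_nat.
Qed.

End Marginals.

(** * Graphs with a K_4 minor *)

Section BranchTable.
Variables (R : realType) (n : nat) (e : rel 'I_n).
Notation bcell := (cell (fun _ : 'I_n => 2%N)).
Notation table := {ffun bcell -> R^o}.
Notation Delta := (graph_complex e).
Variable B : 'I_4 -> {set 'I_n}.
Hypothesis B_disj : forall s t, s != t -> [disjoint B s & B t].

Definition branch_cell (z : cube) : bcell :=
  cell_of (fun i => if [pick s | i \in B s] is Some s then cube_bit s z else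
    false).

Definition branch_table : table :=
  [ffun c => \sum_(z | branch_cell z == c) 4%:R^-1].

Lemma bit_branch_cell s i z : i \in B s -> bit i (branch_cell z) = cube_bit s z.
Proof.
move=> iB; rewrite bit_cell_of; case: pickP => [t it|/(_ s)];
  last by rewrite iB.
have [->//|ts] := eqVneq t s.
by have /disjointFr/(_ it) := B_disj ts; rewrite iB.
Qed.

(** The bit at [i] is a free bit or constant, so it factors through one
    coordinate of the cube. *)
Lemma bit_branch_factor i : exists s (h : bool -> bool),
  forall z, bit i (branch_cell z) = h (cube_bit s z).
Proof.
case: (pickP (fun s => i \in B s)) => [s iB|none].
  by exists s, id => z; rewrite (bit_branch_cell _ iB).
exists ord0, (fun=> false) => z; rewrite bit_cell_of.
by case: pickP => // s; rewrite none.
Qed.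

Lemma mass_branch_table P :
  mass branch_table P = #|[pred z | P (branch_cell z)]|%:R / 4%:R.
Proof.
transitivity (\sum_(z | P (branch_cell z)) 4%:R^-1 : R).
  rewrite (partition_big branch_cell P) //; apply: eq_bigr => c Pc.
  rewrite ffunE; apply: eq_bigl => z.
  by case: eqVneq => [->|]; rewrite ?Pc ?andbF.
by rewrite sumr_const mulr_natl; congr (_ *+ _); apply: eq_card.
Qed.

Lemma mass_branch_table_int P (f : bool -> bool -> bool) s t :
  (forall z, P (branch_cell z) = f (cube_bit s z) (cube_bit t z)) ->
  mass branch_table P \is a Num.int.
Proof.
move=> Pf; rewrite mass_branch_table.
rewrite (eq_card (B := [pred z | f (cube_bit s z) (cube_bit t z)])) => [|z];
  last first.
  by rewrite !inE Pf.
have /dvdnP[k ->] := dvdn_card_cube f s t.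
by rewrite natrM mulfK ?pnatr_eq0 //; apply: intr_nat.
Qed.

Lemma marginal_branch_table_int :
  integral_points (marginal_map Delta branch_table).
Proof.
move=> k; have [F [FD [c0 ->]]] := face_indexP k; rewrite marginal_face.
move: FD; rewrite inE => /or3P[/eqP->|/existsP[i /eqP->]|].
- by refine (@mass_branch_table_int _ (fun _ _ => true) ord0 ord0 _) => z;
    rewrite agree0.
- have [s [h hE]] := bit_branch_factor i.
  refine (@mass_branch_table_int _ (fun a _ => h a == bit i c0) s s _) => z.
  by rewrite agree1 hE.
case/existsP=> i /existsP[j /andP[_ /eqP->]].
have [s [h hE]] := bit_branch_factor i; have [t [k' kE]] := bit_branch_factor j.
refine (@mass_branch_table_int _
  (fun a b => (h a == bit i c0) && (k' b == bit j c0)) s t _) => z.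
by rewrite agree2 hE kE.
Qed.
End BranchTable.

Lemma not_normal_of_K4_minor (R : realType) (n : nat) (e : rel 'I_n) :
  irreflexive e -> is_minor (complete_graph 4) e ->
  ~ marginal_normal R (fun=> 2%N) (graph_complex e).
Proof.
move=> e_irr [B [B0 B_disj B_con B_adj]] normal.
pose x := branch_table R B.
have [y ynat yx] : @marginal_semigroup R n (fun=> 2%N) (graph_complex e)
    (marginal_map (graph_complex e) x).
  rewrite -normal; split; last exact: marginal_branch_table_int.
  by exists x => // c; rewrite ffunE; apply: sumr_ge0 => z _;
    rewrite invr_ge0 ler0n.
have y_ge0 c : 0 <= (y c : R) by apply: natr_ge0; apply: ynat.
have mass0 P c : mass y P = 0 -> P c -> y c = 0.
  move=> yP0 Pc; apply/eqP; rewrite eq_le y_ge0 andbT -yP0 /mass (bigD1 c) //=.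
  by rewrite lerDl; apply: sumr_ge0.
have y1 i s beta : i \in B s -> mass y (fun c => bit i c == beta) = 2%:R.
  move=> iB; rewrite -(bit_cell_of (fun=> beta) i) -(eq_mass _ (agree1 i _)).
  rewrite (marginal_map_inj_agree _ (face1 e i) yx) (eq_mass _ (agree1 i _)).
  rewrite mass_branch_table bit_cell_of.
  rewrite (eq_card (B := [pred z | cube_bit s z == beta])) => [|z]; last first.
    by rewrite !inE (bit_branch_cell B_disj _ iB).
  by rewrite card_cube1; lra.
have y2 i j beta gamma : e i j ->
    mass y (fun c => (bit i c == beta) && (bit j c == gamma)) =
    mass x (fun c => (bit i c == beta) && (bit j c == gamma)).
  move=> eij; pose c0 := @cell_of n (fun k => if k == i then beta else gamma).
  have ci : bit i c0 = beta by rewrite bit_cell_of eqxx.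
  have cj : bit j c0 = gamma.
    by rewrite bit_cell_of; case: eqP eij => // ->; rewrite e_irr.
  rewrite -ci -cj -!(eq_mass _ (agree2 i j c0)).
  exact: (marginal_map_inj_agree _ (face2 eij) yx).
(* adjacent bits of a branch set agree in all cells that x weighs, so the
   event that they differ has mass 0 for x, hence for y *)
have yconst s i j c : y c != 0 -> i \in B s -> j \in B s -> bit i c = bit j c.
  move=> yc iB jB; have /connectP[p pth ->] := B_con s i j iB jB.
  elim: p i iB pth => //= k p IHp i _ /andP[/and3P[iB kB eik]] /(IHp k kB) <-.
  have [//|ne] := eqVneq (bit i c) (bit k c); case/negP: yc; apply/eqP.
  apply: (mass0 (fun c' => (bit i c' == bit i c) && (bit k c' == bit k c))).
    rewrite y2 // mass_branch_table eq_card0 ?mul0r // => z.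
    rewrite !inE !(bit_branch_cell B_disj _ iB) (bit_branch_cell B_disj _ kB).
    by apply: contraNF ne => /andP[/eqP<- /eqP<-].
  by rewrite !eqxx.
have rep_ex s : {i | i \in B s}.
  by apply: sigW; have /set0Pn[i iB] := B0 s; exists i.
pose rep s := sval (rep_ex s); have repB s : rep s \in B s := svalP (rep_ex s).
apply: (@no_orthogonal_array R _ y (fun s => bit (rep s))) => [c||s beta|].
- exact: ynat.
- pose c0 := @cell_of n (fun=> true).
  rewrite -(eq_mass _ (agree0 c0)) (marginal_map_inj_agree _ (face0 e) yx).
  rewrite mass_branch_table (eq_card (B := predT)) => [|z]; last first.
    by rewrite !inE agree0.
  by rewrite cardT -cardE !card_prod !card_bool /=; lra.
- exact: y1.
move=> s t beta gamma st; have [i [j [iB jB eij]]] := B_adj s t st.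
have -> : mass y (fun c => (bit (rep s) c == beta) && (bit (rep t) c == gamma))
  =
    mass y (fun c => (bit i c == beta) && (bit j c == gamma)).
  rewrite !mass_indicator; apply: eq_bigr => c _.
  have [->|yc] := eqVneq (y c) 0; first by rewrite !mul0r.
  by rewrite (yconst s i (rep s)) // (yconst t j (rep t)).
rewrite y2 // mass_branch_table.
rewrite (eq_card (B := [pred z | (cube_bit s z == beta) && (cube_bit t z ==
  gamma)])).
  by rewrite card_cube2 // divff ?pnatr_eq0.
by move=> z; rewrite !inE (bit_branch_cell B_disj _ iB) (bit_branch_cell B_disj
  _ jB).
Qed.

Local Close Scope ring_scope.

Theorem theorem1p2 (R : realType) (n : nat) (n_gt0 : (0 < n)%N)
    (e : rel 'I_n) (e_sym : symmetric e) (e_irr : irreflexive e) :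
  marginal_normal R (fun _ : 'I_n => 2) (graph_complex e) <->
  ~ is_minor (complete_graph 4) e.
Proof.
split; last exact: normal_of_no_K4_minor.
by move=> normal /(not_normal_of_K4_minor e_irr)/(_ normal).
Qed.
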